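(* In intensional Martin-Löf type theory, assume that every type has a constant endofunction, i.e. $\prod_{A:\mathcal U}\sum_{k:A\to A}\prod_{a,b:A}k(a)=k(b)$. Then for every type $X:\mathcal U$ and every relation $R:X\times X\to\mathcal U$ there is a relation $S:X\times X\to\mathcal U$ such that: (i) $S$ is propositionally valued: $\prod_{x,y:X}\mathrm{isProp}(S(x,y))$; (ii) $S$ is functional: $\prod_{x:X}\mathrm{isProp}\big(\sum_{y:X}S(x,y)\big)$; (iii) $S$ is a subrelation of $R$: $\prod_{x,y:X}S(x,y)\to R(x,y)$; (iv) $S$ and $R$ have the same domain: for every $x:X$, $\big(\sum_{y:X}R(x,y)\big)\Leftrightarrow\big(\sum_{y:X}S(x,y)\big)$.
   Context: Intensional Martin-Löf type theory with a universe $\mathcal U$ (and a larger universe containing it as needed), $\Sigma$, $\Pi$, $+$, $\mathbf 0$, $\mathbf 2$ and identity types (J only; no UIP/K). $\mathrm{isProp}(A):\equiv\prod_{a,b:A}a=b$. $A\Leftrightarrow B$ means there are maps in both directions. *)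

(* Defs.v *)
(** One fixed universe [UU]; every type of the object theory lives in it. *)
Definition UU := Type.

(** The identity type is an inductive family in [UU] rather than the
    [Prop]-valued [eq]; its eliminator [Id_rect] is J. *)
Inductive Id {A : UU} (a : A) : A -> UU :=
  idrefl : Id a a.

Definition isProp (A : UU) : UU := forall a b : A, Id a b.

Definition constEndo (A : UU) : UU :=
  {k : A -> A & forall a b : A, Id (k a) (k b)}.

(** [A <-> B] of the standard library is available for [Prop] only. *)
Definition logEquiv (A B : UU) : UU := ((A -> B) * (B -> A))%type.

(* Main.v *)
Require Import Defs.

(** For each [x] let [k] be a constant endofunction of [{y & R (x, y)}], and let
    [S (x, y)] consist of the [r : R (x, y)] such that [(y, r)] is a fixed point
    of [k].  The fixed points of a constant function form a proposition, which
    is inhabited as soon as its domain is; this gives functionality and equality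
    of domains.  Constant endofunctions on the identity types of [X] make [X] a
    set (Hedberg), and over a set, functionality implies that [S] is
    propositionally valued.  Throughout, a type is recognised as a proposition
    by a constant map out of it that has a left inverse. *)

Definition idsym {A : UU} {a b : A} (p : Id a b) : Id b a :=
  match p in Id _ b return Id b a with idrefl _ => idrefl a end.

Definition idtrans {A : UU} {a b c : A} (p : Id a b) (q : Id b c) : Id a c :=
  match q in Id _ c return Id a c with idrefl _ => p end.

Definition idap {A B : UU} (f : A -> B) {a b : A} (p : Id a b) :
  Id (f a) (f b) :=
  match p in Id _ b return Id (f a) (f b) with idrefl _ => idrefl (f a) end.

Definition idtransport {A : UU} (P : A -> UU) {a b : A} (p : Id a b) :
  P a -> P b :=
  match p in Id _ b return P a -> P b with idrefl _ => fun u => u end.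

Lemma idtrans_symKl {A : UU} {a b c : A} (p : Id a b) (q : Id b c) :
  Id (idtrans (idsym p) (idtrans p q)) q.
Proof. destruct q, p; exact (idrefl _). Qed.

Definition isConst {A B : UU} (f : A -> B) : UU :=
  forall a b : A, Id (f a) (f b).

Definition fixedPoints {A : UU} (k : A -> A) : UU := {a : A & Id (k a) a}.

Lemma isProp_of_inhabited {A : UU} : (A -> isProp A) -> isProp A.
Proof. intros propA a; exact (propA a a). Qed.

Lemma isProp_const_section {A B : UU} (f : A -> B) (g : B -> A)
  (gf : forall a : A, Id (g (f a)) a) : isConst f -> isProp A.
Proof.
  intros fconst a b.
  exact (idtrans (idsym (gf a)) (idtrans (idap g (fconst a b)) (gf b))).
Qed.

Lemma isProp_retract {A B : UU} (f : A -> B) (g : B -> A)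
  (gf : forall a : A, Id (g (f a)) a) : isProp B -> isProp A.
Proof.
  intros propB.
  exact (isProp_const_section f g gf (fun a b => propB (f a) (f b))).
Qed.

Lemma isProp_singleton {A : UU} (a : A) : isProp {b : A & Id a b}.
Proof. intros [b p] [c q]; destruct p, q; exact (idrefl _). Qed.

Lemma isProp_fixedPoints {A : UU} (k : A -> A) :
  isConst k -> isProp (fixedPoints k).
Proof.
  intros kconst; apply isProp_of_inhabited; intros [a0 _].
  (* Since [k] is constant, [Id (k a) a] may be replaced by [Id (k a0) a]. *)
  apply (isProp_retract (B := {a : A & Id (k a0) a})
    (fun '(existT _ a p) => existT _ a (idtrans (kconst a0 a) p))
    (fun '(existT _ a p) => existT _ a (idtrans (idsym (kconst a0 a)) p))).
  - intros [a p].
    exact (idap (existT (fun a => Id (k a) a) a)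
             (idtrans_symKl (kconst a0 a) p)).
  - apply isProp_singleton.
Qed.

Lemma logEquiv_fixedPoints {A : UU} (k : A -> A) :
  isConst k -> logEquiv A (fixedPoints k).
Proof.
  intros kconst; split.
  - intros a; exact (existT _ (k a) (kconst (k a) a)).
  - intros u; exact (projT1 u).
Qed.

Lemma hedberg {A : UU} (a : A) (K : forall b : A, constEndo (Id a b)) (b : A) :
  isProp (Id a b).
Proof.
  pose (k := fun c => projT1 (K c)).
  apply (isProp_const_section (k b) (idtrans (idsym (k a (idrefl a))))).
  - intros p; destruct p.
    exact (idtrans_symKl (k a (idrefl a)) (idrefl a)).
  - exact (projT2 (K b)).
Qed.

Lemma isProp_fiber {A : UU} (P : A -> UU) (a : A) :
  isProp (Id a a) -> isProp {b : A & P b} -> isProp (P a).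
Proof.
  intros prop_loops propP; apply isProp_of_inhabited; intros s0.
  pose (path_to_a := fun v => idap (@projT1 A P) (propP v (existT P a s0))).
  apply (isProp_const_section (existT P a)
           (fun v => idtransport P (path_to_a v) (projT2 v))).
  - intros s.
    exact (idap (fun p => idtransport P p s)
             (prop_loops (path_to_a (existT P a s)) (idrefl a))).
  - intros s t; exact (propP (existT P a s) (existT P a t)).
Qed.

Section FixedPart.

Context {A : UU} {P : A -> UU}.
Variable k : {a : A & P a} -> {a : A & P a}.

Definition fixedPart (a : A) : UU :=
  {p : P a & Id (k (existT P a p)) (existT P a p)}.

Definition fixedPoint_of_fixedPart (w : {a : A & fixedPart a}) :
  fixedPoints k :=
  let '(existT _ a (existT _ p e)) := w in existT _ (existT P a p) e.

Definition fixedPart_of_fixedPoint (v : fixedPoints k) :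
  {a : A & fixedPart a} :=
  match v with
  | existT _ (existT _ a p) e => existT fixedPart a (existT _ p e)
  end.

Lemma fixedPoint_of_fixedPartK (w : {a : A & fixedPart a}) :
  Id (fixedPart_of_fixedPoint (fixedPoint_of_fixedPart w)) w.
Proof. destruct w as [a [p e]]; exact (idrefl _). Qed.

Hypothesis kconst : isConst k.

Lemma isProp_total_fixedPart : isProp {a : A & fixedPart a}.
Proof.
  exact (isProp_retract _ _ fixedPoint_of_fixedPartK
           (isProp_fixedPoints k kconst)).
Qed.

Lemma isProp_fixedPart (a : A) : isProp (Id a a) -> isProp (fixedPart a).
Proof.
  intros prop_loops.
  exact (isProp_fiber fixedPart a prop_loops isProp_total_fixedPart).
Qed.

Lemma logEquiv_total_fixedPart :
  logEquiv {a : A & P a} {a : A & fixedPart a}.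
Proof.
  destruct (logEquiv_fixedPoints k kconst) as [to_fixed of_fixed]; split.
  - intros u; exact (fixedPart_of_fixedPoint (to_fixed u)).
  - intros w; exact (of_fixed (fixedPoint_of_fixedPart w)).
Qed.

End FixedPart.

Theorem theorem7p3 (constEndo_all : forall A : UU, constEndo A)
  (X : UU) (R : X * X -> UU) :
  {S : X * X -> UU &
    ((forall x y : X, isProp (S (x, y))) *
     (forall x : X, isProp {y : X & S (x, y)}) *
     (forall x y : X, S (x, y) -> R (x, y)) *
     (forall x : X, logEquiv {y : X & R (x, y)} {y : X & S (x, y)}))%type}.
Proof.
  pose (k := fun x => projT1 (constEndo_all {y : X & R (x, y)})).
  assert (kconst : forall x, isConst (k x))
    by exact (fun x => projT2 (constEndo_all {y : X & R (x, y)})).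
  exists (fun '(x, y) => fixedPart (k x) y); split; [split; [split |] |].
  - intros x y; apply (isProp_fixedPart (k x) (kconst x)).
    exact (hedberg y (fun z => constEndo_all (Id y z)) y).
  - intros x; exact (isProp_total_fixedPart (k x) (kconst x)).
  - intros x y s; exact (projT1 s).
  - intros x; exact (logEquiv_total_fixedPart (k x) (kconst x)).
Qed.
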